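(* Let $s>0$, let $\mathcal{G}=\{g_x\}_{x\in\mathbb{Z}}$ be an $\mathcal{A}^1_s$-self-localized frame for $\mathcal{H}$ with canonical dual $\tilde{\mathcal{G}}=\{\tilde g_x\}$, and write $\mathcal{H}^p=\mathcal{H}^p(\mathcal{G},\tilde{\mathcal{G}})$. Let $\mathcal{F}=\{f_n\}_{n\in\mathbb{Z}}$ be a frame for $\mathcal{H}$ with lower frame bound $A$, and let $\mathcal{E}=\{e_n\}_{n\in\mathbb{Z}}\subset\mathcal{H}$ satisfy $\|e_n-f_n\|_{\mathcal{H}^p}\le\varepsilon_n$ for all $n$ and all $1\le p\le\infty$, where $\sup_n\varepsilon_n\le\varepsilon$. Consider the statements (i) $\sum_{n\in\mathbb{Z}}\|e_n-f_n\|_{\mathcal{H}^\infty}\le\varepsilon$; (ii) $\sup_{x\in\mathbb{Z}}\sum_{n\in\mathbb{Z}}|\langle e_n-f_n,\tilde g_x\rangle|\le\varepsilon$; (iii) $\left\|\sum_{n\in F}c_n(e_n-f_n)\right\|\le\sqrt{\|A(\mathcal{G},\mathcal{G})\|_{\mathcal{A}^1}}\,\varepsilon\left(\sum_{n\in F}|c_n|^2\right)^{1/2}$ for every finite set $F\subset\mathbb{Z}$ and all scalars $(c_n)_{n\in F}$. Then (i) implies (ii) and (ii) implies (iii). Moreover, if $\varepsilon>0$ is small enough (for instance $\sqrt{\|A(\mathcal{G},\mathcal{G})\|_{\mathcal{A}^1}}\,\varepsilon<\sqrt{A}$) and one of (i)–(iii) holds, then $\mathcal{E}$ is a frame for $\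mathcal{H}$.
   Context: A sequence $\{h_n\}_{n\in\mathbb{Z}}$ in a separable Hilbert space $\mathcal{H}$ is a frame with bounds $0<A\le B<\infty$ if $A\|f\|^2\le\sum_n|\langle f,h_n\rangle|^2\le B\|f\|^2$ for all $f\in\mathcal{H}$; its frame operator $Sf=\sum_n\langle f,h_n\rangle h_n$ is boundedly invertible and $\{S^{-1}h_n\}$ is the canonical dual frame. For $s\ge0$, $v_s(x)=(1+|x|)^s$, and the Schur algebra $\mathcal{A}^1_s$ is the set of matrices $M=(m_{kl})_{k,l\in\mathbb{Z}}$ with $\|M\|_{\mathcal{A}^1_s}:=\max\{\sup_k\sum_l|m_{kl}|v_s(k-l),\ \sup_l\sum_k|m_{kl}|v_s(k-l)\}<\infty$; $\mathcal{A}^1:=\mathcal{A}^1_0$. The Gramian $A(\mathcal{G},\mathcal{G})$ has entries $\langle g_x,g_y\rangle$; $\mathcal{G}$ is $\mathcal{A}^1_s$-self-localized if $A(\mathcal{G},\mathcal{G})\in\mathcal{A}^1_s$. Spaces $\mathcal{H}^p(\mathcal{G},\tilde{\mathcal{G}})$: for $1\le p\le2$, $\mathcal{H}^p=\{f\in\mathcal{H}: f=\sum_x\langle f,\tilde g_x\rangle g_x,\ (\langle f,\tilde g_x\rangle)_x\in\ell^p\}$ with norm $\|f\|_{\mathcal{H}^p}=\|(\langle f,\tilde g_x\rangle)_x\|_{\ell^p}$; for $2<p<\infty$, $\mathcal{H}^p$ is the completion of the finite linear combinations of elements of $\mathcal{G}$ in this norm; $\mathcal{H}^\infty:=(\mathcal{H}^1)'$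 with norm $\|f\|_{\mathcal{H}^\infty}=\sup_x|\langle f,\tilde g_x\rangle|$. In particular for $h\in\mathcal{H}$, $\|h\|_{\mathcal{H}^1}=\sum_x|\langle h,\tilde g_x\rangle|$ and $\|h\|_{\mathcal{H}^\infty}=\sup_x|\langle h,\tilde g_x\rangle|$. *)

(* Defs.v *)
From HB Require Import structures.
From mathcomp Require Import all_boot all_order all_algebra.
From mathcomp Require Import all_classical all_reals all_analysis.
From mathcomp Require Import complex.
Set Implicit Arguments. Unset Strict Implicit. Unset Printing Implicit Defensive.
Import Order.TTheory GRing.Theory Num.Theory.
Local Open Scope classical_set_scope.
Local Open Scope ring_scope.

Section Hilbert.
Context {R : realType} {V : lmodType (complex R)}.
Variable ip : V -> V -> complex R.

Definition cabs (z : complex R) : R := Num.sqrt (complex.Re z ^+ 2 + complex.Im z ^+ 2).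

Definition hnorm (f : V) : R := Num.sqrt (complex.Re (ip f f)).

Definition is_hilbert : Prop :=
  (forall (a : complex R) (f g h : V), ip (a *: f + g) h = a * ip f h + ip g h) /\
      (forall f g : V, ip g f = conjc (ip f g)) /\
      (forall f : V, complex.Im (ip f f) = 0 /\ 0 <= complex.Re (ip f f)) /\
      (forall f : V, ip f f = 0 -> f = 0) /\
      (forall u : nat -> V,
         (forall e : R, 0 < e -> exists N : nat, forall m n : nat,
            (N <= m)%N -> (N <= n)%N -> hnorm (u m - u n) < e) ->
         exists l : V, forall e : R, 0 < e -> exists N : nat, forall n : nat,
            (N <= n)%N -> hnorm (u n - l) < e) /\
      (exists d : nat -> V, forall (f : V) (e : R), 0 < e ->
         exists k : nat, hnorm (f - d k) < e).

Definition frame_bounds (h : int -> V) (A B : R) : Prop :=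
  0 < A /\ A <= B /\
  forall f : V,
    ((A * hnorm f ^+ 2)%:E <= \esum_(n in [set: int]) ((cabs (ip f (h n))) ^+ 2)%:E)%E /\
    (\esum_(n in [set: int]) ((cabs (ip f (h n))) ^+ 2)%:E <= (B * hnorm f ^+ 2)%:E)%E.

Definition is_frame (h : int -> V) : Prop := exists A B : R, frame_bounds h A B.

Definition has_csum (u : int -> complex R) (l : complex R) : Prop :=
  forall e : R, 0 < e -> exists N : nat, forall n : nat, (N <= n)%N ->
    cabs (\sum_(i < (2 * n).+1) u (i%:Z - n%:Z) - l) < e.

(* v = S f where S is the frame operator of h (weak form: <v,g> = sum_n <f,h_n><h_n,g>) *)
Definition frame_op_eq (h : int -> V) (f v : V) : Prop :=
  forall g : V, has_csum (fun n => ip f (h n) * ip (h n) g) (ip v g).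

(* gt is the canonical dual frame of g:  gt_x = S^{-1} g_x, i.e. S gt_x = g_x *)
Definition canonical_dual (g gt : int -> V) : Prop :=
  forall x : int, frame_op_eq g (gt x) (g x).

Definition vs (s : R) (k : int) : R := (1 + (`|k|%:~R : R)) `^ s.

Definition schur_norm (s : R) (M : int -> int -> complex R) : \bar R :=
  maxe (ereal_sup [set \esum_(l in [set: int]) (cabs (M k l) * vs s (k - l))%:E
                    | k in [set: int]])
       (ereal_sup [set \esum_(k in [set: int]) (cabs (M k l) * vs s (k - l))%:E
                    | l in [set: int]]).

Definition gram (g : int -> V) : int -> int -> complex R :=
  fun x y => ip (g x) (g y).

Definition self_localized (s : R) (g : int -> V) : Prop :=
  (schur_norm s (gram g) < +oo)%E.

Definition lp_norm (p : \bar R) (c : int -> R) : \bar R :=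
  match p with
  | r%:E => ((\esum_(x in [set: int]) ((`|c x|) `^ r)%:E) `^ r^-1)%E
  | _ => ereal_sup [set (`|c x|)%:E | x in [set: int]]
  end.

Definition Hp_norm (gt : int -> V) (p : \bar R) (f : V) : \bar R :=
  lp_norm p (fun x => cabs (ip f (gt x))).

End Hilbert.

(* Main.v *)
Require Import Defs.
From HB Require Import structures.
From mathcomp Require Import all_boot all_order all_algebra.
From mathcomp Require Import all_classical all_reals all_analysis.
From mathcomp Require Import complex.
From mathcomp Require Import finmap zify ring lra.
Import Order.TTheory GRing.Theory Num.Theory.
Local Open Scope classical_set_scope.
Local Open Scope ring_scope.

(** The frame operator [S] of [g] is onto (Richardson iteration), so every [u]
    is [S v] and [<u, gt x> = <v, g x>], since [gt x] is the preimage of [g x]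
    and [S] is symmetric. Hence [|u|^2 = sum_x <v, g x> <g x, u>] is at most
    [|(<u, gt x>)_x|_2 * sqrt C * |u|], where the Schur test bounds the Gramian
    by its Schur norm [C]. A second Schur test, on the matrix
    [<e n - f n, gt x>] whose row and column sums are at most [eps], bounds the
    coefficients of [u = sum_n c n *: (e n - f n)] and gives (ii) -> (iii).
    By duality (iii) is a Bessel bound for [e - f], and Minkowski's inequality
    turns it into frame bounds for [e]. *)

(** * Inequalities for finite real sums *)

(** Divides a norm out of [|u|^2 <= |u| * K] without splitting off [|u| = 0]: if [y < x], then [x]
    is positive and [x * y < x ^+ 2]. *)
Lemma ge_of_sqr_le_mul (R : realDomainType) (x y : R) :
  0 <= y -> x ^+ 2 <= x * y -> x <= y.
Proof.
move=> y0 xy; rewrite leNgt; apply/negP => yx; move: xy; apply/negP.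
by rewrite -ltNge expr2 ltr_pM2l // (le_lt_trans y0).
Qed.

(** Induction on the list: the hypothesis gives [|S| <= sqrt P * sqrt Q], so by the inequality of
    arithmetic and geometric means the cross term [2 * (x * y * S)] is at most
    [x ^+ 2 * Q + y ^+ 2 * P]. *)
Lemma cauchy_schwarz_sum (R : rcfType) (I : Type) (r : seq I) (a b : I -> R) :
  (\sum_(i <- r) a i * b i) ^+ 2 <=
  (\sum_(i <- r) a i ^+ 2) * (\sum_(i <- r) b i ^+ 2).
Proof.
elim: r => [|i r IH]; first by rewrite !big_nil mul0r expr2 mul0r.
rewrite !big_cons.
set S := \sum_(j <- r) a j * b j in IH *.
have : 0 <= \sum_(j <- r) a j ^+ 2 by apply: sumr_ge0 => j _; exact: sqr_ge0.
have : 0 <= \sum_(j <- r) b j ^+ 2 by apply: sumr_ge0 => j _; exact: sqr_ge0.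
move: IH; set P := \sum_(j <- r) a j ^+ 2; set Q := \sum_(j <- r) b j ^+ 2.
move: (a i) (b i) => x y IH Q0 P0.
have SPQ : `|S| <= Num.sqrt P * Num.sqrt Q.
  by rewrite -sqrtrM // -sqrtr_sqr ler_sqrt // mulr_ge0.
have xyS : x * y * S <= `|x| * `|y| * (Num.sqrt P * Num.sqrt Q).
  apply: le_trans (ler_norm _) _; rewrite !normrM.
  by apply: ler_wpM2l => //; rewrite mulr_ge0.
have := sqr_ge0 (`|x| * Num.sqrt Q - `|y| * Num.sqrt P).
rewrite sqrrB !exprMn !sqr_sqrtr // !real_normK ?num_real // => amgm.
have -> : (x * y + S) ^+ 2 = x ^+ 2 * y ^+ 2 + S ^+ 2 + 2 * (x * y * S) by ring.
have -> : (x ^+ 2 + P) * (y ^+ 2 + Q) =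
  x ^+ 2 * y ^+ 2 + P * Q + (x ^+ 2 * Q + y ^+ 2 * P) by ring.
rewrite -addrA -[leRHS]addrA lerD2l lerD //.
move: amgm xyS; lra.
Qed.

Lemma cauchy_schwarz_sum_sqrt (R : rcfType) (I : Type) (r : seq I)
    (a b : I -> R) :
  \sum_(i <- r) a i * b i <=
  Num.sqrt (\sum_(i <- r) a i ^+ 2) * Num.sqrt (\sum_(i <- r) b i ^+ 2).
Proof.
apply: le_trans (ler_norm _) _.
rewrite -sqrtr_sqr -sqrtrM; last by apply: sumr_ge0 => i _; exact: sqr_ge0.
by apply: ler_wsqrtr; exact: cauchy_schwarz_sum.
Qed.

Lemma minkowski_sum (R : rcfType) (I : Type) (r : seq I) (a b : I -> R) :
  Num.sqrt (\sum_(i <- r) (a i + b i) ^+ 2) <=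
  Num.sqrt (\sum_(i <- r) a i ^+ 2) + Num.sqrt (\sum_(i <- r) b i ^+ 2).
Proof.
have sq0 (c : I -> R) : 0 <= \sum_(i <- r) c i ^+ 2.
  by apply: sumr_ge0 => i _; exact: sqr_ge0.
rewrite -[leRHS]ger0_norm ?addr_ge0 // -sqrtr_sqr; apply: ler_wsqrtr.
rewrite sqrrD !sqr_sqrtr //.
have -> : \sum_(i <- r) (a i + b i) ^+ 2 = \sum_(i <- r) a i ^+ 2 +
    (\sum_(i <- r) a i * b i) *+ 2 + \sum_(i <- r) b i ^+ 2.
  by rewrite -sumrMnl -!big_split /=; apply: eq_bigr => i _; rewrite sqrrD.
by rewrite lerD2r lerD2l lerMn2r cauchy_schwarz_sum_sqrt orbT.
Qed.

(** Cauchy-Schwarz on the splitting [t * c = sqrt t * (sqrt t * c)]: the first factor contributes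
    the row bound [a], and exchanging the two sums turns the second into the column bound [b]. *)
Lemma schur_test (R : rcfType) (I J : Type) (X : seq I) (Y : seq J)
    (t : I -> J -> R) (c : J -> R) (a b : R) :
  (forall x y, 0 <= t x y) -> 0 <= a ->
  (forall x, \sum_(y <- Y) t x y <= a) -> (forall y, \sum_(x <- X) t x y <= b) ->
  \sum_(x <- X) (\sum_(y <- Y) t x y * c y) ^+ 2 <= a * b * \sum_(y <- Y) c y ^+ 2.
Proof.
move=> t0 a0 ta tb.
apply: (@le_trans _ _ (\sum_(x <- X) a * \sum_(y <- Y) t x y * c y ^+ 2)).
  apply: ler_sum => x _.
  have -> : \sum_(y <- Y) t x y * c y =
      \sum_(y <- Y) Num.sqrt (t x y) * (Num.sqrt (t x y) * c y).
    by apply: eq_bigr => y _; rewrite mulrA -expr2 sqr_sqrtr.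
  apply: le_trans (cauchy_schwarz_sum _ _ _ _ _) _.
  under eq_bigr do rewrite sqr_sqrtr //.
  under [X in _ * X <= _]eq_bigr do rewrite exprMn sqr_sqrtr //.
  by apply: ler_wpM2r => //; apply: sumr_ge0 => y _; rewrite mulr_ge0 ?sqr_ge0.
rewrite -mulr_sumr -mulrA ler_wpM2l // exchange_big /= mulr_sumr.
by apply: ler_sum => y _; rewrite -mulr_suml ler_wpM2r ?sqr_ge0.
Qed.

Lemma sum_uniq_subset (U : nmodType) (T : eqType) (r r' : seq T) (a : T -> U) :
  uniq r -> uniq r' -> {subset r <= r'} ->
  \sum_(i <- r') a i = \sum_(i <- r) a i + \sum_(i <- r' | i \notin r) a i.
Proof.
move=> ur ur' rr'; rewrite (bigID (mem r)) /=; congr (_ + _).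
rewrite -big_filter; apply: perm_big; apply: uniq_perm => //.
  exact: filter_uniq.
by move=> x; rewrite mem_filter; case: (boolP (x \in r)) => //= /rr' ->.
Qed.

Lemma ler_sum_subset (R : numDomainType) (T : eqType) (r r' : seq T)
    (a : T -> R) : uniq r -> uniq r' -> {subset r <= r'} ->
  (forall i, 0 <= a i) -> \sum_(i <- r) a i <= \sum_(i <- r') a i.
Proof.
move=> ur ur' rr' a0; rewrite (sum_uniq_subset _ _ _ _ _ ur ur' rr') lerDl.
exact: sumr_ge0.
Qed.

(** * Unordered sums described by finite partial sums *)

Lemma esum_leP (R : realType) (T : choiceType) (a : T -> \bar R) (M : \bar R) :
  (\esum_(i in [set: T]) a i <= M)%E <->
  (forall r : seq T, uniq r -> (\sum_(i <- r) a i <= M)%E).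
Proof.
split=> [aM r ur|aM].
  apply: le_trans aM; apply: esum_ge; exists [set` r].
    by split => //; exact: finite_seq.
  by rewrite -fsbig_seq.
apply: ge_ereal_sup => _ [X [finX _] <-].
by rewrite fsbig_finite //; apply: aM; exact: fset_uniq.
Qed.

Lemma esum_EFin_leP (R : realType) (T : choiceType) (a : T -> R) (M : R) :
  (\esum_(i in [set: T]) (a i)%:E <= M%:E)%E <->
  (forall r : seq T, uniq r -> \sum_(i <- r) a i <= M).
Proof.
split=> [/esum_leP aM r /aM|aM]; first by rewrite sumEFin lee_fin.
by apply/esum_leP => r /aM; rewrite sumEFin lee_fin.
Qed.

(** Quantifying over all real upper bounds [M] covers an infinite sum as well: it has no such bound,
    and the right-hand side is then vacuous. *)
Lemma le_esum_EFin (R : realType) (T : choiceType) (a : T -> R) (K : R) :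
  (K%:E <= \esum_(i in [set: T]) (a i)%:E)%E <->
  (forall M : R, (forall r : seq T, uniq r -> \sum_(i <- r) a i <= M) -> K <= M).
Proof.
split=> [Ka M /esum_EFin_leP aM|KM]; first by rewrite -lee_fin (le_trans Ka).
case E : (\esum_(i in [set: T]) (a i)%:E)%E => [M| |].
- by rewrite lee_fin; apply: KM; apply/esum_EFin_leP; rewrite E.
- by rewrite leey.
(* The value [-oo] is impossible, since the empty partial sum would be at most [-1]. *)
- have /esum_EFin_leP /(_ [::] isT) :
      (\esum_(i in [set: T]) (a i)%:E <= (-1)%:E)%E by rewrite E leNye.
  by rewrite big_nil oppr_ge0 ler10.
Qed.

(** * The modulus of a complex number *)

Section ComplexModulus.
Context {R : realType}.
Implicit Types z w : complex R.

Lemma cabsE z : cabs z = Normc.normc z.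
Proof. by case: z. Qed.

Lemma cabs_ge0 z : 0 <= cabs z.
Proof. exact: sqrtr_ge0. Qed.

Lemma cabs0 : cabs (0 : complex R) = 0.
Proof. by rewrite cabsE Normc.normc0. Qed.

Lemma cabsM z w : cabs (z * w) = cabs z * cabs w.
Proof. by rewrite !cabsE Normc.normcM. Qed.

Lemma ler_cabsD z w : cabs (z + w) <= cabs z + cabs w.
Proof. by rewrite !cabsE le_normcD. Qed.

Lemma cabsJ z : cabs (conjc z) = cabs z.
Proof. by case: z => a b; rewrite /cabs /= sqrrN. Qed.

Lemma cabsN z : cabs (- z) = cabs z.
Proof. by case: z => a b; rewrite /cabs /= !sqrrN. Qed.

Lemma cabs_distC z w : cabs (z - w) = cabs (w - z).
Proof. by rewrite -cabsN opprB. Qed.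

Lemma cabs_real (x : R) : cabs (x%:C)%C = `|x|.
Proof. by rewrite /cabs /= expr0n /= addr0 sqrtr_sqr. Qed.

Lemma cabs0_eq0 z : cabs z = 0 -> z = 0.
Proof. by rewrite cabsE => /Normc.eq0_normc. Qed.

Lemma mulcJ z : z * conjc z = ((cabs z ^+ 2)%:C)%C.
Proof.
case: z => a b; rewrite /cabs sqr_sqrtr ?addr_ge0 ?sqr_ge0 //=.
by apply/eqP; rewrite eq_complex /=; apply/andP; split; apply/eqP; ring.
Qed.

Lemma ler_norm_Re z : `|complex.Re z| <= cabs z.
Proof. by rewrite -sqrtr_sqr; apply: ler_wsqrtr; rewrite lerDl sqr_ge0. Qed.

Lemma ReD z w : complex.Re (z + w) = complex.Re z + complex.Re w.
Proof. by case: z; case: w. Qed.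

Lemma ReN z : complex.Re (- z) = - complex.Re z.
Proof. by case: z. Qed.

Lemma Re_sum I (r : seq I) (F : I -> complex R) :
  complex.Re (\sum_(i <- r) F i) = \sum_(i <- r) complex.Re (F i).
Proof. by apply: (big_morph _ ReD). Qed.

Lemma ler_cabs_sum I (r : seq I) (F : I -> complex R) :
  cabs (\sum_(i <- r) F i) <= \sum_(i <- r) cabs (F i).
Proof.
elim: r => [|i r IH]; first by rewrite !big_nil cabs0.
by rewrite !big_cons; apply: le_trans (ler_cabsD _ _) _; rewrite lerD2l.
Qed.

End ComplexModulus.

(** * Inner product geometry, synthesis and analysis of finite families *)

Section InnerProduct.
Context {R : realType} {V : lmodType (complex R)} {ip : V -> V -> complex R}.
Hypothesis ip_hilbert : is_hilbert ip.
Local Notation hnorm := (hnorm ip).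
Implicit Types (u v w : V) (h : int -> V).

Lemma ip_linear (a : complex R) u v w : ip (a *: u + v) w = a * ip u w + ip v w.
Proof. by case: ip_hilbert => H _; exact: H. Qed.

Lemma ip_conj u v : ip v u = conjc (ip u v).
Proof. by case: ip_hilbert => _ [H _]; exact: H. Qed.

Lemma ip0l w : ip 0 w = 0.
Proof.
have := ip_linear 1 0 0 w; rewrite scale1r addr0 mul1r => /eqP.
by rewrite -subr_eq0 opprD addrA subrr sub0r oppr_eq0 => /eqP.
Qed.

Lemma ipZl (a : complex R) u w : ip (a *: u) w = a * ip u w.
Proof. by rewrite -[a *: u]addr0 ip_linear ip0l addr0. Qed.

Lemma ipDl u v w : ip (u + v) w = ip u w + ip v w.
Proof. by rewrite -{1}[u]scale1r ip_linear mul1r. Qed.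

Lemma ipNl u w : ip (- u) w = - ip u w.
Proof. by rewrite -scaleN1r ipZl mulN1r. Qed.

Lemma ipBl u v w : ip (u - v) w = ip u w - ip v w.
Proof. by rewrite ipDl ipNl. Qed.

Lemma ipZr (a : complex R) u w : ip w (a *: u) = conjc a * ip w u.
Proof. by rewrite (ip_conj (a *: u)) ipZl rmorphM /= -ip_conj. Qed.

Lemma ipDr u v w : ip w (u + v) = ip w u + ip w v.
Proof. by rewrite (ip_conj (u + v)) ipDl rmorphD /= -!ip_conj. Qed.

Lemma ipNr u w : ip w (- u) = - ip w u.
Proof. by rewrite (ip_conj (- u)) ipNl rmorphN /= -!ip_conj. Qed.

Lemma ipBr u v w : ip w (u - v) = ip w u - ip w v.
Proof. by rewrite ipDr ipNr. Qed.

Lemma ip_suml I (r : seq I) (F : I -> V) w :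
  ip (\sum_(i <- r) F i) w = \sum_(i <- r) ip (F i) w.
Proof. by apply: (big_morph (ip^~ w)) => [x y|]; rewrite ?ipDl ?ip0l. Qed.

Lemma hnorm_ge0 u : 0 <= hnorm u.
Proof. exact: sqrtr_ge0. Qed.

Lemma sqr_hnorm u : hnorm u ^+ 2 = complex.Re (ip u u).
Proof.
by case: ip_hilbert => _ [_ [H _]]; rewrite sqr_sqrtr //; case: (H u).
Qed.

Lemma ip_self u : ip u u = ((hnorm u ^+ 2)%:C)%C.
Proof.
rewrite sqr_hnorm; case: ip_hilbert => _ [_ [/(_ u) [H _] _]].
by case: (ip u u) H => a b /= ->.
Qed.

Lemma hnorm0_eq0 u : hnorm u = 0 -> u = 0.
Proof.
move=> u0; case: ip_hilbert => _ [_ [_ [H _]]]; apply: H.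
by rewrite ip_self u0 expr0n.
Qed.

Lemma hnorm0 : hnorm 0 = 0.
Proof. by rewrite /Defs.hnorm ip0l sqrtr0. Qed.

Lemma hnorm_opp u : hnorm (- u) = hnorm u.
Proof. by rewrite /Defs.hnorm ipNl ipNr opprK. Qed.

Lemma hnorm_distC u v : hnorm (u - v) = hnorm (v - u).
Proof. by rewrite -hnorm_opp opprB. Qed.

Lemma cauchy_schwarz u v : cabs (ip u v) <= hnorm u * hnorm v.
Proof.
have [v0|v0] := eqVneq (hnorm v) 0.
  rewrite v0 mulr0 (hnorm0_eq0 _ v0) (ip_conj 0) cabsJ.
  by rewrite ip0l cabs0.
have vp : 0 < hnorm v by rewrite lt_def v0 hnorm_ge0.
(* This is [|v|^2] times the component of [u] orthogonal to [v], scaled so as to avoid a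
   division. *)
pose w := ((hnorm v ^+ 2)%:C)%C *: u - ip u v *: v.
have : 0 <= complex.Re (ip w w) by rewrite -sqr_hnorm sqr_ge0.
have -> : ip w w = ((hnorm v ^+ 2 *
    (hnorm u ^+ 2 * hnorm v ^+ 2 - cabs (ip u v) ^+ 2))%:C)%C.
  rewrite /w !(ipBl, ipBr, ipZl, ipZr) !ip_self (ip_conj u v) conjc_real.
  have realE (a b d : R) :
      ((b * (a * b - d))%:C = b%:C * (a%:C * b%:C - d%:C))%C.
    by rewrite rmorphM rmorphB rmorphM.
  by rewrite realE -mulcJ; ring.
rewrite /= pmulr_rge0 ?exprn_gt0 // subr_ge0 -exprMn.
by rewrite ler_sqr ?nnegrE ?mulr_ge0 ?cabs_ge0 ?hnorm_ge0.
Qed.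

Lemma ler_hnormD u v : hnorm (u + v) <= hnorm u + hnorm v.
Proof.
rewrite -(@ler_sqr R) ?nnegrE ?addr_ge0 ?hnorm_ge0 //.
rewrite sqr_hnorm !(ipDl, ipDr) !ReD -!sqr_hnorm sqrrD.
have Re_ip x y : complex.Re (ip x y) <= hnorm x * hnorm y.
  exact: le_trans (le_trans (ler_norm _) (ler_norm_Re _)) (cauchy_schwarz _ _).
by have := Re_ip u v; have := Re_ip v u; lra.
Qed.

(** Duality: with the coefficients [c n = <w, h n>], the pairing of the synthesized vector with [w]
    is exactly the sum of squares [Q], so [Q <= K * sqrt Q * |w|]. *)
Lemma synthesis_bessel (h : int -> V) (r : seq int) (K : R) : 0 <= K ->
  (forall c : int -> complex R, hnorm (\sum_(n <- r) c n *: h n) <=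
     K * Num.sqrt (\sum_(n <- r) cabs (c n) ^+ 2)) ->
  forall w, Num.sqrt (\sum_(n <- r) cabs (ip w (h n)) ^+ 2) <= K * hnorm w.
Proof.
move=> K0 hK w; set Q := \sum_(n <- r) _.
have Q0 : 0 <= Q by apply: sumr_ge0 => n _; rewrite sqr_ge0.
apply: ge_of_sqr_le_mul; first by rewrite mulr_ge0 ?hnorm_ge0.
rewrite sqr_sqrtr //.
have QE : ip (\sum_(n <- r) ip w (h n) *: h n) w = (Q%:C)%C.
  rewrite ip_suml /Q rmorph_sum /=; apply: eq_bigr => n _.
  by rewrite ipZl (ip_conj w) mulcJ.
have := cauchy_schwarz (\sum_(n <- r) ip w (h n) *: h n) w.
rewrite QE cabs_real ger0_norm // => /le_trans; apply.
rewrite mulrA [Num.sqrt Q * K]mulrC ler_wpM2r ?hnorm_ge0 //; exact: hK.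
Qed.

(** The converse duality, obtained by pairing the synthesized vector [u] with itself and applying
    the analysis bound at [w = u]. *)
Lemma bessel_synthesis (h : int -> V) (r : seq int) (K : R) : 0 <= K ->
  (forall w, Num.sqrt (\sum_(n <- r) cabs (ip w (h n)) ^+ 2) <= K * hnorm w) ->
  forall c : int -> complex R, hnorm (\sum_(n <- r) c n *: h n) <=
     K * Num.sqrt (\sum_(n <- r) cabs (c n) ^+ 2).
Proof.
move=> K0 hK c; set u := \sum_(n <- r) _.
apply: ge_of_sqr_le_mul; first by rewrite mulr_ge0 ?sqrtr_ge0.
have -> : hnorm u ^+ 2 = cabs (ip u u).
  by rewrite ip_self cabs_real ger0_norm ?sqr_ge0.
rewrite {1}/u ip_suml; apply: le_trans (ler_cabs_sum _ _ _) _.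
under eq_bigr do rewrite ipZl cabsM (ip_conj u) cabsJ.
apply: le_trans (cauchy_schwarz_sum_sqrt _ _ _ _ _) _.
rewrite mulrC mulrA ler_wpM2r ?sqrtr_ge0 // mulrC; exact: hK.
Qed.

(** The squared norm is the quadratic form of the Gramian at [c]; the Schur test bounds this matrix
    on [l^2] by [C], whence the constant [sqrt C]. *)
Lemma gram_synthesis (g : int -> V) (r : seq int) (C : R) : 0 <= C ->
  (forall x, \sum_(y <- r) cabs (ip (g x) (g y)) <= C) ->
  (forall y, \sum_(x <- r) cabs (ip (g x) (g y)) <= C) ->
  forall c : int -> complex R, hnorm (\sum_(x <- r) c x *: g x) <=
     Num.sqrt C * Num.sqrt (\sum_(x <- r) cabs (c x) ^+ 2).
Proof.
move=> C0 rowC colC c; set u := \sum_(x <- r) _; set P := \sum_(x <- r) _ ^+ 2.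
have P0 : 0 <= P by apply: sumr_ge0 => x _; rewrite sqr_ge0.
rewrite -(@ler_sqr R) ?nnegrE ?mulr_ge0 ?sqrtr_ge0 //.
rewrite exprMn (sqr_sqrtr C0) (sqr_sqrtr P0).
have -> : hnorm u ^+ 2 = cabs (ip u u).
  by rewrite ip_self cabs_real ger0_norm ?sqr_ge0.
rewrite {1}/u ip_suml; apply: le_trans (ler_cabs_sum _ _ _) _.
have gu x : cabs (ip (g x) u) <=
    \sum_(y <- r) cabs (ip (g x) (g y)) * cabs (c y).
  rewrite ip_conj cabsJ /u ip_suml; apply: le_trans (ler_cabs_sum _ _ _) _.
  by apply: ler_sum => y _; rewrite ipZl cabsM mulrC (ip_conj (g y)) cabsJ.
apply: (@le_trans _ _ (\sum_(x <- r) cabs (c x) *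
    \sum_(y <- r) cabs (ip (g x) (g y)) * cabs (c y))).
  by apply: ler_sum => x _; rewrite ipZl cabsM ler_wpM2l ?cabs_ge0.
apply: le_trans (cauchy_schwarz_sum_sqrt _ _ _ _ _) _.
apply: (@le_trans _ _ (Num.sqrt P * Num.sqrt (C * C * P))).
  rewrite ler_wpM2l ?sqrtr_ge0 //; apply: ler_wsqrtr.
  by apply: schur_test => // x y; exact: cabs_ge0.
rewrite sqrtrM ?mulr_ge0 // -expr2 sqrtr_sqr ger0_norm //.
by rewrite mulrCA -expr2 sqr_sqrtr.
Qed.

End InnerProduct.

(** * Symmetric integer windows [[-n, n]] and the convergence of sums along them *)

Definition window (n : nat) : seq int :=
  [seq (nat_of_ord i)%:Z - n%:Z | i <- index_enum 'I_(2 * n).+1].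

Lemma sum_window (U : nmodType) (a : int -> U) (n : nat) :
  \sum_(i < (2 * n).+1) a ((nat_of_ord i)%:Z - n%:Z) = \sum_(x <- window n) a x.
Proof. by rewrite big_map. Qed.

Lemma window_uniq (n : nat) : uniq (window n).
Proof.
rewrite map_inj_uniq ?index_enum_uniq // => i j /addIr /eqP.
by rewrite eqz_nat => /eqP /val_inj.
Qed.

Lemma mem_window (n : nat) (x : int) : (x \in window n) = (`|x| <= n%:Z).
Proof.
apply/mapP/idP => [[i _ ->]|xn].
  have := ltn_ord i; lia.
have xP : (absz (x + n%:Z)%R < (2 * n).+1)%N by lia.
by exists (Ordinal xP); rewrite ?mem_index_enum //=; lia.
Qed.

(** Links the two kinds of summation: [has_csum] sees only symmetric windows, while the frame bounds
    speak of arbitrary finite sets. *)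
Lemma window_subset (r : seq int) :
  exists N, forall n, (N <= n)%N -> {subset r <= window n}.
Proof.
elim: r => [|x r [N IH]]; first by exists 0%N.
exists (maxn N (absz x)) => n; rewrite geq_max => /andP[Nn xn] y.
rewrite inE => /orP[/eqP ->|]; last exact: IH.
by rewrite mem_window; lia.
Qed.

Lemma window_mono (m n : nat) : (m <= n)%N -> {subset window m <= window n}.
Proof. by move=> mn x; rewrite !mem_window; lia. Qed.

Section SymmetricSums.
Context {R : realType}.
Implicit Types (a b : int -> complex R) (l : complex R).

Lemma has_csum_le {a l} (K : R) : has_csum a l ->
  (forall r, uniq r -> cabs (\sum_(x <- r) a x) <= K) -> cabs l <= K.
Proof.
move=> al aK; apply/ler_addgt0Pr => d d0; have [N /(_ N (leqnn _))] := al d d0.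
rewrite sum_window => /ltW Nd; rewrite -[l](subrK (\sum_(x <- window N) a x)).
apply: le_trans (ler_cabsD _ _) _; rewrite cabs_distC addrC lerD //.
exact/aK/window_uniq.
Qed.

Lemma has_csum_Re_ge {a l} (K : R) : has_csum a l ->
  (exists N, forall n, (N <= n)%N -> K <= complex.Re (\sum_(x <- window n) a x)) ->
  K <= complex.Re l.
Proof.
move=> al [N aK]; apply/ler_addgt0Pr => d d0; have [M MP] := al d d0.
have := MP _ (leq_maxr N M); rewrite sum_window => /ltW Nd.
apply: le_trans (aK _ (leq_maxl N M)) _; rewrite -lerBlDl -ReN -ReD.
by apply: le_trans Nd; apply: le_trans (ler_norm _) (ler_norm_Re _).
Qed.

Lemma has_csum_unique {a l l'} : has_csum a l -> has_csum a l' -> l = l'.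
Proof.
move=> al al'; apply/eqP; rewrite -subr_eq0; apply/eqP/cabs0_eq0/eqP.
rewrite eq_le cabs_ge0 andbT; apply/ler_addgt0Pr => d d0; rewrite add0r.
have d2 : 0 < d / 2 by rewrite divr_gt0.
have [N NP] := al _ d2; have [M MP] := al' _ d2.
have := NP _ (leq_maxl N M); have := MP _ (leq_maxr N M).
rewrite !sum_window; set S := \sum_(x <- _) _ => S1 S2.
have -> : l - l' = (S - l') - (S - l) by ring.
by apply: le_trans (ler_cabsD _ _) _; rewrite cabsN; lra.
Qed.

Lemma has_csum_conj {a l} : has_csum a l -> has_csum (conjc \o a) (conjc l).
Proof.
move=> al d d0; have [N NP] := al d d0; exists N => n /NP.
by rewrite !sum_window -[X in X < _ -> _]cabsJ rmorphB rmorph_sum.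
Qed.

Lemma has_csum_linear {a b l l'} (k : complex R) :
  has_csum a l -> has_csum b l' -> has_csum (fun x => k * a x + b x) (k * l + l').
Proof.
move=> al bl d d0; have k0 : 0 < cabs k + 1 by rewrite ltr_wpDl ?cabs_ge0.
(* Adding 1 to [cabs k] keeps the divisor positive when [k = 0]. *)
have d1 : 0 < d / 2 / (cabs k + 1) by rewrite !divr_gt0.
have d2 : 0 < d / 2 by rewrite divr_gt0.
have [N NP] := al _ d1; have [M MP] := bl _ d2; exists (maxn N M) => n.
rewrite geq_max => /andP[/NP + /MP].
rewrite big_split /= -mulr_sumr !sum_window; set S := \sum_(x <- _) a x.
set T := \sum_(x <- _) b x; rewrite ltr_pdivlMr // => S1 T1.
have -> : k * S + T - (k * l + l') = k * (S - l) + (T - l') by ring.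
apply: le_lt_trans (ler_cabsD _ _) _; rewrite cabsM.
by have := cabs_ge0 (S - l); nra.
Qed.

End SymmetricSums.

Lemma nondecreasing_bounded_cauchy (R : realType) (a : nat -> R) (M : R) :
  (forall m n, (m <= n)%N -> a m <= a n) -> (forall n, a n <= M) ->
  forall d, 0 < d -> exists N, forall n, (N <= n)%N -> a n < a N + d.
Proof.
move=> amono aM d d0; have supA : has_sup (range a).
  by split; [exists (a 0%N); exists 0%N|exists M => _ [n _ <-]].
have [_ [N _ <-] Nd] := sup_adherent d0 supA.
exists N => n _; rewrite -ltrBlDr; apply: le_lt_trans Nd; rewrite lerD2r.
by apply: ub_le_sup; [case: supA|exists n].
Qed.

(** * The frame operator, kept as a relation: [S v u] says that [u] is the image of [v] *)

Section FrameOperator.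
Context {R : realType} {V : lmodType (complex R)} {ip : V -> V -> complex R}.
Hypothesis ip_hilbert : is_hilbert ip.
Local Notation hnorm := (hnorm ip).
Variable g : int -> V.
Local Notation S := (frame_op_eq ip g).
Implicit Types (u v w : V).

Lemma frame_op_linear {u v u' v'} (k : complex R) :
  S v u -> S v' u' -> S (k *: v + v') (k *: u + u').
Proof.
move=> Su Su' w; rewrite ip_linear //.
have := has_csum_linear k (Su w) (Su' w).
rewrite /has_csum => H d /H [N NP]; exists N => n /NP.
under eq_bigr do rewrite mulrA -mulrDl -(ip_linear ip_hilbert).
by [].
Qed.

(** Both sides are the sum of the same series [<v, g x> <g x, v'>]: one tests the image of [v]
    against [v'], the other conjugates the image of [v'] tested against [v]. *)
Lemma frame_op_sym {u v u' v'} : S v u -> S v' u' -> ip u v' = ip v u'.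
Proof.
move=> Su Su'; apply: has_csum_unique (Su v') _.
rewrite (ip_conj ip_hilbert u'); have := has_csum_conj (Su' v).
rewrite /has_csum => H d /H [N NP]; exists N => n /NP /=.
under eq_bigr do rewrite rmorphM /= -!(ip_conj ip_hilbert) mulrC.
by [].
Qed.

(** Tested against [v] itself, the series for [<u, v>] has the terms [|<v, g x>|^2], which are
    non-negative, so large windows dominate the sum over [r]. *)
Lemma frame_op_coercive {u v} (r : seq int) : S v u -> uniq r ->
  \sum_(x <- r) cabs (ip v (g x)) ^+ 2 <= complex.Re (ip u v).
Proof.
move=> Su ur; apply: (has_csum_Re_ge _ (Su v)).
have [N NP] := window_subset r; exists N => n /NP rn.
rewrite Re_sum; under [leRHS]eq_bigr => x _.
  rewrite [ip (g x) v](ip_conj ip_hilbert) mulcJ.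
over.
by apply: ler_sum_subset => // [|i]; [exact: window_uniq|exact: sqr_ge0].
Qed.

Variable b : R.
Hypothesis b0 : 0 <= b.
Hypothesis bessel : forall r, uniq r ->
  forall w, Num.sqrt (\sum_(x <- r) cabs (ip w (g x)) ^+ 2) <= b * hnorm w.

(** Testing against [u] gives [|u|^2 = sum_x <v, g x> <g x, u>], and Cauchy-Schwarz applies. Keeping
    [D] separate from [b] allows a bound on the coefficients of [v] that does not pass through
    [|v|]. *)
Lemma frame_op_bound {u v} (D : R) : S v u ->
  (forall r, uniq r -> Num.sqrt (\sum_(x <- r) cabs (ip v (g x)) ^+ 2) <= D) ->
  hnorm u <= D * b.
Proof.
move=> Su vD; have D0 : 0 <= D := le_trans (sqrtr_ge0 _) (vD [::] isT).
apply: ge_of_sqr_le_mul; first by rewrite mulr_ge0.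
have -> : hnorm u ^+ 2 = cabs (ip u u).
  by rewrite ip_self // cabs_real ger0_norm ?sqr_ge0.
apply: (has_csum_le _ (Su u)) => r ur.
apply: le_trans (ler_cabs_sum _ _ _) _.
under eq_bigr do rewrite cabsM (ip_conj ip_hilbert u) cabsJ.
apply: le_trans (cauchy_schwarz_sum_sqrt _ _ _ _ _) _.
rewrite mulrCA [hnorm u * b]mulrC.
by apply: ler_pM; rewrite ?sqrtr_ge0 ?vD ?bessel.
Qed.

Lemma frame_op_bounded {u v} : S v u -> hnorm u <= b ^+ 2 * hnorm v.
Proof.
move=> Su; rewrite expr2 -mulrA mulrC; apply: (frame_op_bound _ Su) => r ur.
exact: bessel.
Qed.

(** The increments of the partial sums [T n] are controlled by those of the bounded monotone
    sequence [a n], so completeness yields a limit; Cauchy-Schwarz then passes to the weak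
    identity. *)
Lemma frame_op_total v : exists u, S v u.
Proof.
pose T n := \sum_(x <- window n) ip v (g x) *: g x.
pose a n := \sum_(x <- window n) cabs (ip v (g x)) ^+ 2.
have sq0 x : 0 <= cabs (ip v (g x)) ^+ 2 by exact: sqr_ge0.
have amono m n : (m <= n)%N -> a m <= a n.
  by move=> mn; apply: ler_sum_subset => //;
    [exact: window_uniq|exact: window_uniq|exact: window_mono].
have a_ub n : a n <= (b * hnorm v) ^+ 2.
  rewrite -[leLHS]sqr_sqrtr ?sumr_ge0 //.
  by rewrite ler_sqr ?nnegrE ?sqrtr_ge0 ?mulr_ge0 ?hnorm_ge0 // bessel ?window_uniq.
have T_diff m n : (m <= n)%N -> hnorm (T n - T m) <= b * Num.sqrt (a n - a m).
  move=> mn; have um := window_uniq m; have un := window_uniq n.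
  rewrite /T /a !(sum_uniq_subset _ _ _ _ _ um un (window_mono _ _ mn)).
  have diffE (U : zmodType) (p q : U) : p + q - p = q.
    by rewrite addrAC subrr add0r.
  (* The sums over indices outside the smaller window become sums over a filtered list, to which the
     synthesis bound applies. *)
  rewrite !diffE -[X in hnorm X]big_filter -[X in Num.sqrt X]big_filter.
  apply: bessel_synthesis => // w; apply: bessel; exact: filter_uniq.
have Tcauchy (d : R) : 0 < d ->
    exists N, forall n, (N <= n)%N -> hnorm (T n - T N) < d.
  move=> d0; have d1 : 0 < (d / (b + 1)) ^+ 2.
    by rewrite exprn_gt0 // divr_gt0 // ltr_wpDl.
  have [N NP] := nondecreasing_bounded_cauchy _ _ _ amono a_ub _ d1.
  exists N => n Nn; apply: le_lt_trans (T_diff _ _ Nn) _.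
  have : Num.sqrt (a n - a N) < d / (b + 1).
    rewrite -[ltRHS]ger0_norm ?divr_ge0 ?ltW ?ltr_wpDl // -sqrtr_sqr.
    by rewrite ltr_sqrt // ltrBlDl; exact: NP.
  rewrite ltr_pdivlMr ?ltr_wpDl //.
  by have := sqrtr_ge0 (a n - a N); nra.
have [u Tu] : exists l, forall d, 0 < d ->
    exists N, forall n, (N <= n)%N -> hnorm (T n - l) < d.
  case: ip_hilbert => _ [_ [_ [_ [complete _]]]]; apply: complete => d d0.
  have d2 : 0 < d / 2 by rewrite divr_gt0.
  have [N NP] := Tcauchy _ d2.
  exists N => m n /NP Nm /NP Nn.
  have -> : T m - T n = (T m - T N) + (T N - T n) by rewrite addrA subrK.
  apply: le_lt_trans (ler_hnormD ip_hilbert _ _) _.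
  by rewrite (hnorm_distC ip_hilbert (T N)); lra.
exists u => w d d0.
have d1 : 0 < d / (hnorm w + 1) by rewrite divr_gt0 // ltr_wpDl // hnorm_ge0.
have [N NP] := Tu _ d1; exists N => n /NP.
rewrite (sum_window _ (fun x => ip v (g x) * ip (g x) w)).
under [X in cabs (X - _)]eq_bigr do rewrite -(ipZl ip_hilbert).
rewrite -(ip_suml ip_hilbert) -(ipBl ip_hilbert) ltr_pdivlMr ?ltr_wpDl ?hnorm_ge0 // => Hn.
apply: le_lt_trans (cauchy_schwarz ip_hilbert _ _) _.
by have := hnorm_ge0 (ip := ip) (T n - u); rewrite -/(T n); nra.
Qed.

(** * Consequences of the lower frame bound: injectivity and surjectivity *)

Variable A : R.
Hypothesis A0 : 0 < A.
Hypothesis lower : forall v (M : R),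
  (forall r, uniq r -> \sum_(x <- r) cabs (ip v (g x)) ^+ 2 <= M) ->
  A * hnorm v ^+ 2 <= M.

Lemma frame_op_lower {u v} : S v u -> A * hnorm v ^+ 2 <= complex.Re (ip u v).
Proof. by move=> Su; apply: lower => r; exact: frame_op_coercive. Qed.

Lemma frame_op_expansive {u v} : S v u -> A * hnorm v <= hnorm u.
Proof.
move=> Su; have [v0|v0] := eqVneq (hnorm v) 0; first by rewrite v0 mulr0 hnorm_ge0.
have vp : 0 < hnorm v by rewrite lt_def v0 hnorm_ge0.
rewrite -(ler_pM2r vp) -mulrA -expr2; apply: le_trans (frame_op_lower Su) _.
exact: le_trans (le_trans (ler_norm _) (ler_norm_Re _)) (cauchy_schwarz ip_hilbert _ _).
Qed.

(** By linearity [u - u'] is an image of 0, and boundedness makes its norm vanish. This turns the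
    relation [S] into a function. *)
Lemma frame_op_unique {u u' v} : S v u -> S v u' -> u = u'.
Proof.
move=> Su Su'; have := frame_op_bounded (frame_op_linear (-1) Su' Su).
rewrite !scaleN1r !addNr hnorm0 // mulr0 addrC => H.
by apply/eqP; rewrite -subr_eq0; apply/eqP/(hnorm0_eq0 ip_hilbert)/le_anti;
  rewrite H hnorm_ge0.
Qed.

Hypothesis Ab : A <= b ^+ 2.

(* The step [A / b ^+ 4] minimises [t |-> 1 - 2 * t * A + t ^+ 2 * b ^+ 4],
   which bounds the squared norm of [1 - t S]. *)
Lemma frame_op_relax {u v} : S v u ->
  hnorm (v - ((A / b ^+ 4)%:C)%C *: u) ^+ 2 <=
  (1 - A ^+ 2 / b ^+ 4) * hnorm v ^+ 2.
Proof.
have b2 : 0 < b ^+ 2 := lt_le_trans A0 Ab.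
move=> Su; set t := A / b ^+ 4.
have t0 : 0 <= t by rewrite divr_ge0 ?ltW // -[4%N]/(2 * 2)%N exprM exprn_gt0.
have -> : hnorm (v - (t%:C)%C *: u) ^+ 2 = hnorm v ^+ 2
    - 2 * t * complex.Re (ip u v) + t ^+ 2 * hnorm u ^+ 2.
  rewrite (sqr_hnorm ip_hilbert) (ipBl ip_hilbert) !(ipBr ip_hilbert).
  rewrite !(ipZl ip_hilbert) !(ipZr ip_hilbert) conjc_real.
  rewrite (ip_conj ip_hilbert u v) !(ip_self ip_hilbert).
  by case: (ip u v) => x y /=; ring.
have low := frame_op_lower Su; have up := frame_op_bounded Su.
have {}up : hnorm u ^+ 2 <= b ^+ 4 * hnorm v ^+ 2.
  rewrite -[4%N]/(2 * 2)%N exprM -exprMn ler_sqr ?nnegrE ?hnorm_ge0 //.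
  by rewrite mulr_ge0 ?hnorm_ge0 // ltW.
have -> : 1 - A ^+ 2 / b ^+ 4 = 1 - 2 * t * A + t ^+ 2 * b ^+ 4.
  rewrite /t; field.
  by apply: contraTneq b2 => ->; rewrite expr0n ltxx.
have := ler_wpM2l t0 low.
have := ler_wpM2l (sqr_ge0 t) up.
nra.
Qed.

(* Richardson iteration: the residuals [r n = u - S (x n)] satisfy
   [r n.+1 = r n - t *: S (r n)] and decay geometrically; as [S] is expansive
   up to a factor, [x] is then a Cauchy sequence. *)
Lemma frame_op_surjective u : exists v, S v u.
Proof.
have b2 : 0 < b ^+ 2 := lt_le_trans A0 Ab.
have b4 : 0 < b ^+ 4 by rewrite -[4%N]/(2 * 2)%N exprM exprn_gt0.
have [Sf SfP] := choice frame_op_total.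
pose x := fix x n : V :=
  if n is m.+1 then x m + ((A / b ^+ 4)%:C)%C *: (u - Sf (x m)) else 0.
pose r n := u - Sf (x n).
have SfB v w : Sf (v - w) = Sf v - Sf w.
  apply: (frame_op_unique (SfP _)).
  have := frame_op_linear (-1) (SfP w) (SfP v).
  by rewrite !scaleN1r ![- _ + _]addrC.
have rS n : r n.+1 = r n - ((A / b ^+ 4)%:C)%C *: Sf (r n).
  rewrite /r /= -addrA; congr (_ + _); rewrite -opprD; congr (- _).
  apply: (frame_op_unique (SfP _)); rewrite addrC [X in S _ X]addrC.
  exact: frame_op_linear.
pose q := 1 - A ^+ 2 / b ^+ 4.
(* [A <= b ^+ 2] makes the contraction factor [q] non-negative. *)
have q0 : 0 <= q.
  rewrite /q subr_ge0 ler_pdivrMr // mul1r -[4%N]/(2 * 2)%N exprM.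
  by rewrite ler_sqr ?nnegrE ?(ltW A0) ?(ltW b2).
have q1 : `|q| < 1.
  by rewrite ger0_norm // /q ltrBlDr ltrDl divr_gt0 // exprn_gt0.
have r_bound n : hnorm (r n) ^+ 2 <= q ^+ n * hnorm (r 0%N) ^+ 2.
  elim: n => [|n IH]; first by rewrite mul1r.
  rewrite rS; apply: le_trans (frame_op_relax (SfP _)) _.
  by rewrite [q ^+ n.+1]exprS -[leRHS]mulrA; apply: ler_wpM2l.
have r_small (d : R) : 0 < d -> exists N, forall n, (N <= n)%N -> hnorm (r n) < d.
  (* The added 1 allows division by [c] even when the initial residual is zero. *)
  move=> d0; pose c := hnorm (r 0%N) ^+ 2 + 1.
  have c0 : 0 < c by rewrite ltr_wpDl ?sqr_ge0.
  have /cvgrPdist_lt /(_ (d ^+ 2 / c)) := cvg_expr q1.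
  rewrite divr_gt0 ?exprn_gt0 // => /(_ isT) [N _ NP]; exists N => n Nn.
  rewrite -(@ltr_sqr R) ?nnegrE ?hnorm_ge0 ?ltW //.
  apply: le_lt_trans (r_bound n) _.
  have := NP n Nn; rewrite /= sub0r normrN ger0_norm ?exprn_ge0 //.
  rewrite ltr_pdivlMr // => /le_lt_trans; apply.
  by rewrite ler_wpM2l ?exprn_ge0 // lerDl.
(* [S (x m - x n)] is a difference of residuals, and [S] expands norms by at least the factor
   [A]. *)
have x_diff m n : A * hnorm (x m - x n) <= hnorm (r m) + hnorm (r n).
  apply: le_trans (frame_op_expansive (SfP _)) _.
  have -> : Sf (x m - x n) = r n - r m.
    by rewrite SfB /r opprB [RHS]addrC addrA subrK.
  rewrite addrC; apply: le_trans (ler_hnormD ip_hilbert _ _) _.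
  by rewrite (hnorm_opp ip_hilbert).
have [v xv] : exists l, forall d, 0 < d ->
    exists N, forall n, (N <= n)%N -> hnorm (x n - l) < d.
  case: ip_hilbert => _ [_ [_ [_ [complete _]]]]; apply: complete => d d0.
  have Ad : 0 < A * (d / 2) by rewrite !(mulr_gt0, divr_gt0).
  have [N NP] := r_small _ Ad.
  exists N => m n /NP Nm /NP Nn; rewrite -(ltr_pM2l A0).
  by apply: le_lt_trans (x_diff _ _) _; lra.
(* Split [u - S v = r n + S (x n - v)]. Each term gets [d / 2]; the second needs [x n] within
   [d / 2 / b ^+ 2] of [v], as [S] multiplies norms by at most [b ^+ 2]. *)
exists v; suff -> : u = Sf v by [].
apply/eqP; rewrite -subr_eq0; apply/eqP/(hnorm0_eq0 ip_hilbert)/le_anti.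
rewrite hnorm_ge0 andbT; apply/ler_addgt0Pr => d d0; rewrite add0r.
have d1 : 0 < d / 2 / b ^+ 2 by rewrite !divr_gt0.
have d2 : 0 < d / 2 by rewrite divr_gt0.
have [N NP] := r_small _ d2.
have [M MP] := xv _ d1.
have := NP _ (leq_maxl N M); have := MP _ (leq_maxr N M).
set n := maxn N M; rewrite ltr_pdivlMr // mulrC => xn rn.
have -> : u - Sf v = r n + Sf (x n - v) by rewrite SfB /r addrA subrK.
apply: le_trans (ler_hnormD ip_hilbert _ _) _.
have := frame_op_bounded (SfP (x n - v)); lra.
Qed.

End FrameOperator.

(** * Schur norms and the sums they control *)

Section SchurNorm.
Context {R : realType}.
Implicit Type M : int -> int -> complex R.

Lemma schur_norm_row (s : R) M k :
  (\esum_(l in [set: int]) (cabs (M k l) * vs s (k - l))%:E <= schur_norm s M)%E.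
Proof. by rewrite le_max; apply/orP; left; apply: ereal_sup_ubound; exists k. Qed.

Lemma schur_norm_col (s : R) M l :
  (\esum_(k in [set: int]) (cabs (M k l) * vs s (k - l))%:E <= schur_norm s M)%E.
Proof. by rewrite le_max; apply/orP; right; apply: ereal_sup_ubound; exists l. Qed.

Lemma vs0 k : vs (0 : R) k = 1.
Proof. exact: powRr0. Qed.

(** The weight [vs] increases with its exponent because its base is at least 1. Hence weighted
    localization makes the unweighted Schur norm of the Gramian finite. *)
Lemma schur_norm0_le (s : R) M : 0 <= s -> (schur_norm 0 M <= schur_norm s M)%E.
Proof.
move=> s0; have vs_le k l :
    ((cabs (M k l) * vs 0 (k - l))%:E <= (cabs (M k l) * vs s (k - l))%:E)%E.
  rewrite lee_fin ler_wpM2l ?cabs_ge0 //; apply: ler_powR => //.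
  by rewrite lerDl ler0z.
rewrite ge_max; apply/andP; split; apply: ge_ereal_sup => _ [x _ <-].
  by apply: le_trans (schur_norm_row s M x); apply: le_esum.
by apply: le_trans (schur_norm_col s M x); apply: le_esum.
Qed.

Lemma schur_norm_ge0 (s : R) M : (0 <= schur_norm s M)%E.
Proof.
apply: le_trans (schur_norm_row s M 0); apply: esum_ge0 => l _.
by rewrite lee_fin mulr_ge0 ?cabs_ge0 ?powR_ge0.
Qed.

Lemma schur_norm0_sums M : (schur_norm 0 M < +oo)%E ->
  forall r : seq int, uniq r ->
    (forall k, \sum_(l <- r) cabs (M k l) <= fine (schur_norm 0 M)) /\
    (forall l, \sum_(k <- r) cabs (M k l) <= fine (schur_norm 0 M)).
Proof.
move=> Moo r ur; have Mfin : schur_norm 0 M \is a fin_num.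
  by rewrite ge0_fin_numE // schur_norm_ge0.
split=> [k|l].
  have := schur_norm_row 0 M k; rewrite -(fineK Mfin) => /esum_EFin_leP /(_ r ur).
  by under eq_bigr do rewrite vs0 mulr1.
have := schur_norm_col 0 M l; rewrite -(fineK Mfin) => /esum_EFin_leP /(_ r ur).
by under eq_bigr do rewrite vs0 mulr1.
Qed.

End SchurNorm.

(** * The two extreme coefficient norms, [p = 1] and [p = +oo] *)

Section HpNorm.
Context {R : realType} {V : lmodType (complex R)} {ip : V -> V -> complex R}.
Variable gt : int -> V.

Lemma Hp_norm1E w : Hp_norm ip gt 1%:E w =
  \esum_(x in [set: int]) (cabs (ip w (gt x)))%:E.
Proof.
rewrite /Hp_norm /lp_norm invr1 poweRe1; last first.
  by apply: esum_ge0 => x _; rewrite lee_fin powR_ge0.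
by apply: eq_esum => x _; rewrite ger0_norm ?powRr1 ?cabs_ge0.
Qed.

Lemma Hp_norm_ooE w : Hp_norm ip gt +oo%E w =
  ereal_sup [set (cabs (ip w (gt x)))%:E | x in [set: int]].
Proof.
rewrite /Hp_norm /lp_norm; congr ereal_sup; apply: eq_imagel => x _.
by rewrite ger0_norm ?cabs_ge0.
Qed.

(** The step from (i) to (ii): for each fixed [x], every term is at most its supremum over [x]. *)
Lemma Hp_norm_oo_sup (h : int -> V) (K : \bar R) :
  (\esum_(n in [set: int]) Hp_norm ip gt +oo%E (h n) <= K)%E ->
  (ereal_sup [set \esum_(n in [set: int]) (cabs (ip (h n) (gt x)))%:E
              | x in [set: int]] <= K)%E.
Proof.
move=> hK; apply: ge_ereal_sup => _ [x _ <-]; apply: le_trans hK.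
apply: le_esum => n _; rewrite Hp_norm_ooE.
by apply: ereal_sup_ubound; exists x.
Qed.

End HpNorm.

(** * From dual coefficients to synthesis bounds and perturbed frames *)

Section FramePerturbation.
Context {R : realType} {V : lmodType (complex R)} {ip : V -> V -> complex R}.
Hypothesis ip_hilbert : is_hilbert ip.
Local Notation hnorm := (hnorm ip).
Implicit Types (g gt h : int -> V).

Lemma frame_bounds_finite {h} {A B : R} : frame_bounds ip h A B ->
  (forall v (M : R),
    (forall r, uniq r -> \sum_(x <- r) cabs (ip v (h x)) ^+ 2 <= M) ->
    A * hnorm v ^+ 2 <= M) /\
  (forall r, uniq r -> forall v,
    Num.sqrt (\sum_(x <- r) cabs (ip v (h x)) ^+ 2) <= Num.sqrt B * hnorm v).
Proof.
move=> [A0 [AB hAB]]; have B0 : 0 <= B := ltW (lt_le_trans A0 AB); split.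
  by move=> v M; case: (hAB v) => /le_esum_EFin + _; exact.
move=> r ur v; case: (hAB v) => _ /esum_EFin_leP /(_ r ur) hB.
rewrite -[hnorm v]ger0_norm ?hnorm_ge0 // -sqrtr_sqr -sqrtrM //.
exact: ler_wsqrtr.
Qed.

(** Two Bessel bounds of [g] serve here: [sqrt B], from the frame inequality, to solve [S v = u],
    and [sqrt C], from the Gramian, to obtain the stated constant. *)
Lemma norm_le_dual_coefs {g gt} (D : R) u : is_frame ip g ->
  (schur_norm 0 (gram ip g) < +oo)%E -> canonical_dual ip g gt ->
  (forall r, uniq r -> Num.sqrt (\sum_(x <- r) cabs (ip u (gt x)) ^+ 2) <= D) ->
  hnorm u <= D * Num.sqrt (fine (schur_norm 0 (gram ip g))).
Proof.
move=> [A [B gAB]] Coo gtg uD; have [lower upper] := frame_bounds_finite gAB.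
case: gAB => A0 [AB _]; have B0 : 0 <= B := ltW (lt_le_trans A0 AB).
have AB' : A <= Num.sqrt B ^+ 2 by rewrite sqr_sqrtr.
have [v Sv] := frame_op_surjective ip_hilbert _ _ (sqrtr_ge0 B) upper _ A0 lower AB' u.
have C0 : 0 <= fine (schur_norm 0 (gram ip g)) by rewrite fine_ge0 ?schur_norm_ge0.
apply: (frame_op_bound ip_hilbert _ _ (sqrtr_ge0 _) _ _ Sv) => r ur.
  have [row col] := schur_norm0_sums _ Coo _ ur.
  apply: (synthesis_bessel ip_hilbert); rewrite ?sqrtr_ge0 //.
  exact: gram_synthesis.
have := uD r ur; under eq_bigr do rewrite (frame_op_sym ip_hilbert _ Sv (gtg _)).
by [].
Qed.

Lemma synthesis_le_of_dual_sums {g gt h} (eps : R) : is_frame ip g ->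
  (schur_norm 0 (gram ip g) < +oo)%E -> canonical_dual ip g gt -> 0 <= eps ->
  (forall n, (\esum_(x in [set: int]) (cabs (ip (h n) (gt x)))%:E <= eps%:E)%E) ->
  (forall x, (\esum_(n in [set: int]) (cabs (ip (h n) (gt x)))%:E <= eps%:E)%E) ->
  forall (F : seq int) (c : int -> complex R), uniq F ->
    hnorm (\sum_(n <- F) c n *: h n) <=
      Num.sqrt (fine (schur_norm 0 (gram ip g))) * eps
      * Num.sqrt (\sum_(n <- F) cabs (c n) ^+ 2).
Proof.
move=> gframe Coo gtg eps0 row col F c uF.
rewrite -mulrA mulrC; apply: norm_le_dual_coefs gframe Coo gtg _ => r ur.
rewrite -[eps]ger0_norm // -sqrtr_sqr -sqrtrM ?sqr_ge0 //.
apply: ler_wsqrtr; rewrite [eps ^+ 2]expr2.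
(* The matrix is indexed by [(x, n)], so its row sums run over [n] and are bounded by [col], its
   column sums by [row]. *)
have test := schur_test _ _ _ r F (fun x n => cabs (ip (h n) (gt x)))
  (fun n => cabs (c n)) eps eps.
apply: le_trans (test _ eps0 _ _) => [|x n|x|n]; last 3 first.
- exact: cabs_ge0.
- exact: (esum_EFin_leP _ _ _ _).1 (col x) F uF.
- exact: (esum_EFin_leP _ _ _ _).1 (row n) r ur.
apply: ler_sum => x _; rewrite ler_sqr ?nnegrE ?cabs_ge0 //; last first.
  by apply: sumr_ge0 => n _; rewrite mulr_ge0 ?cabs_ge0.
rewrite (ip_suml ip_hilbert); apply: le_trans (ler_cabs_sum _ _ _) _.
by apply: ler_sum => n _; rewrite (ipZl ip_hilbert) cabsM mulrC.
Qed.

Lemma analysis_ler_add (a h : int -> V) (r : seq int) v :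
  Num.sqrt (\sum_(n <- r) cabs (ip v (a n)) ^+ 2) <=
  Num.sqrt (\sum_(n <- r) cabs (ip v (h n)) ^+ 2) +
  Num.sqrt (\sum_(n <- r) cabs (ip v (h n - a n)) ^+ 2).
Proof.
apply: le_trans (minkowski_sum _ _ _ _ _); apply: ler_wsqrtr.
apply: ler_sum => n _; rewrite ler_sqr ?nnegrE ?addr_ge0 ?cabs_ge0 //.
have -> : ip v (a n) = ip v (h n) - ip v (h n - a n).
  by rewrite (ipBr ip_hilbert) subKr.
by rewrite -[cabs (ip v (h n - a n))]cabsN; exact: ler_cabsD.
Qed.

Lemma frame_perturbation {f e : int -> V} {A B : R} (K : R) :
  frame_bounds ip f A B -> 0 <= K -> K < Num.sqrt A ->
  (forall (F : seq int) (c : int -> complex R), uniq F ->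
    hnorm (\sum_(n <- F) c n *: (e n - f n)) <=
      K * Num.sqrt (\sum_(n <- F) cabs (c n) ^+ 2)) ->
  is_frame ip e.
Proof.
move=> fAB K0 KA efK; have [lower upper] := frame_bounds_finite fAB.
case: fAB => A0 [AB _]; have B0 : 0 <= B := ltW (lt_le_trans A0 AB).
have efbessel r v : uniq r ->
    Num.sqrt (\sum_(n <- r) cabs (ip v (e n - f n)) ^+ 2) <= K * hnorm v.
  by move=> ur; apply: (synthesis_bessel ip_hilbert) => // c; exact: efK.
(* The analysis norms of [e] and [f] at [v] differ by at most [K * |v|], so the square roots of the
   frame bounds move by at most [K]. *)
exists ((Num.sqrt A - K) ^+ 2), ((Num.sqrt B + K) ^+ 2); split; last split.
- by rewrite exprn_gt0 // subr_gt0.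
- have sAB : Num.sqrt A <= Num.sqrt B by exact: ler_wsqrtr.
  by rewrite ler_sqr ?nnegrE; have := sqrtr_ge0 B; lra.
move=> v; have v0 : 0 <= hnorm v := hnorm_ge0 v.
have sq0 r (h : int -> V) : 0 <= \sum_(n <- r) cabs (ip v (h n)) ^+ 2.
  by apply: sumr_ge0 => n _; exact: sqr_ge0.
split; last first.
  apply/esum_EFin_leP => r ur; rewrite -exprMn -[leLHS]sqr_sqrtr //.
  have KB : 0 <= Num.sqrt B + K by rewrite addr_ge0 ?sqrtr_ge0.
  rewrite ler_sqr ?nnegrE ?sqrtr_ge0 ?mulr_ge0 //.
  apply: le_trans (analysis_ler_add e f r v) _; rewrite mulrDl.
  apply: lerD; first exact: upper.
  apply: le_trans (efbessel r v ur); apply: ler_wsqrtr; apply: ler_sum => n _.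
  by rewrite -opprB (ipNr ip_hilbert) cabsN.
(* For any bound [M] on the finite sums of [e], the sums of [f] are at most [(sqrt M + K * |v|)^2];
   the lower bound of [f] then gives [sqrt A * |v| <= sqrt M + K * |v|]. *)
apply/le_esum_EFin => M eM.
have M0 : 0 <= M by have := eM [::] isT; rewrite big_nil.
rewrite -exprMn -[leRHS]sqr_sqrtr //.
have AK : 0 <= Num.sqrt A - K by rewrite subr_ge0 ltW.
rewrite ler_sqr ?nnegrE ?sqrtr_ge0 ?mulr_ge0 //.
rewrite mulrBl lerBlDr.
have MK : 0 <= Num.sqrt M + K * hnorm v by rewrite addr_ge0 ?sqrtr_ge0 ?mulr_ge0.
rewrite -(@ler_sqr R) ?nnegrE ?mulr_ge0 ?sqrtr_ge0 // exprMn (sqr_sqrtr (ltW A0)).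
apply: lower => r ur; rewrite -[leLHS]sqr_sqrtr //.
rewrite ler_sqr ?nnegrE ?sqrtr_ge0 //.
apply: le_trans (analysis_ler_add f e r v) _; apply: lerD.
  by apply: ler_wsqrtr; exact: eM.
exact: efbessel.
Qed.

End FramePerturbation.

Theorem mainTheorem3 (R : realType) (V : lmodType (complex R))
  (ip : V -> V -> complex R) (s : R) (g gt : int -> V) (f e : int -> V)
  (A : R) (epsn : int -> R) (eps : R) :
  is_hilbert ip ->
  0 < s ->
  is_frame ip g -> self_localized ip s g -> canonical_dual ip g gt ->
  (exists B : R, frame_bounds ip f A B) ->
  (forall (n : int) (p : \bar R), (1 <= p)%E ->
      (Hp_norm ip gt p (e n - f n) <= (epsn n)%:E)%E) ->
  (forall n : int, epsn n <= eps) ->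
  let cond_i : Prop :=
    (\esum_(n in [set: int]) Hp_norm ip gt +oo%E (e n - f n) <= eps%:E)%E in
  let cond_ii : Prop :=
    (ereal_sup [set \esum_(n in [set: int]) (cabs (ip (e n - f n) (gt x)))%:E
                 | x in [set: int]] <= eps%:E)%E in
  let cond_iii : Prop :=
    forall (F : seq int) (c : int -> complex R), uniq F ->
      hnorm ip (\sum_(n <- F) c n *: (e n - f n))
        <= Num.sqrt (fine (schur_norm 0 (gram ip g))) * eps
           * Num.sqrt (\sum_(n <- F) cabs (c n) ^+ 2) in
  (cond_i -> cond_ii) /\ (cond_ii -> cond_iii) /\
  (Num.sqrt (fine (schur_norm 0 (gram ip g))) * eps < Num.sqrt A ->
     cond_i \/ cond_ii \/ cond_iii -> is_frame ip e).
Proof.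
move=> ip_hilbert s0 gframe gloc gtg [B fAB] Hp_le epsn_le cond_i cond_ii cond_iii.
have Coo : (schur_norm 0 (gram ip g) < +oo)%E.
  exact: le_lt_trans (schur_norm0_le _ _ (ltW s0)) gloc.
(* The case [p = 1] of the hypothesis supplies the sums over [x]; (ii) supplies those over [n]. *)
have row n :
    (\esum_(x in [set: int]) (cabs (ip (e n - f n) (gt x)))%:E <= eps%:E)%E.
  rewrite -Hp_norm1E; apply: le_trans (Hp_le n _ (lexx _)) _.
  by rewrite lee_fin.
(* The sign of [eps] follows from the empty partial sum. *)
have eps0 : 0 <= eps.
  by have /esum_EFin_leP /(_ [::] isT) := row 0; rewrite big_nil.
have i_ii : cond_i -> cond_ii by exact: Hp_norm_oo_sup.
have ii_iii : cond_ii -> cond_iii.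
  move=> sup_le; apply: synthesis_le_of_dual_sums gframe Coo gtg eps0 row _ => //.
  by move=> x; apply: le_trans sup_le; apply: ereal_sup_ubound; exists x.
split=> //; split=> // small cond; have {cond} iii : cond_iii by tauto.
apply: (frame_perturbation ip_hilbert _ fAB _ small iii).
by rewrite mulr_ge0 ?sqrtr_ge0.
Qed.
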